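(* Let $N:=\{1,\dots,N\}$ be a finite set of individuals and $X:=\{1,\dots,M\}$ a finite set of allocations, and consider the space of all possible preference profiles $P=(P_i)_{i\in N}$ on $X$, compared by the relation $\trianglerighteq$. (a) A preference profile $\overline{P}$ is both a $\trianglerighteq$-maximal element and a $\trianglerighteq$-upper bound if and only if there exists a unique $x^*\in X$ such that all individuals like $x^*$ the best under $\overline{P}$, i.e., $R(\overline{P},x^* )=\mathbf{1}_N=(1,\dots,1)$. (b) A preference profile $\underline{P}$ is a $\trianglerighteq$-minimal element if and only if both of the following hold: (i) every allocation in $X$ is Pareto efficient under $\underline{P}$, i.e., $PE(\underline{P})=X$; (ii) $\underline{P}$ is strict.
   Context: $N$ denotes both the number of individuals and the set $\{1,\dots,N\}$. A preference $P_i$ on $X$ is an ordinal preference relation (complete and transitive weak preference $\succsim_{P_i}$, with strict part $\succ_{P_i}$ and indifference part $\sim_{P_i}$). A preference profile is $P=(P_i)_{i\in N}$. $P$ is strict if for every $i\in N$ and any two distinct $x,x'\in X$ either $x\succ_{P_i}x'$ or $x'\succ_{P_i}x$. Ranking: $R(P_i,x):=1+\#\{z\in X: z\succ_{P_i}x\}$, and the ranking vector is $R(P,x):=(R(P_1,x),\dots,R(P_N,x))$. Inequalities $\le$ between ranking vectors are componentwise. $PE(P)$ is the set of $x\in X$ not Pareto dominated by any $z\in X$, where $z$ Pareto dominates $x$ under $P$ if $z\succsim_{P_i}x$ for all $i\in N$ and $z\succ_{P_i}x$ for some $i\in N$. Order: $P\trianglerighteq P'$ if there exists an onto mapping $\psi:PE(P')\to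 PE(P)$ such that $R(P,\psi(x))\le R(P',x)$ for every $x\in PE(P')$. Write $P\triangleq P'$ if $P\trianglerighteq P'$ and $P'\trianglerighteq P$. $P$ is a $\trianglerighteq$-maximal element if $P'\trianglerighteq P$ implies $P'\triangleq P$; a $\trianglerighteq$-minimal element if $P\trianglerighteq P'$ implies $P\triangleq P'$; a $\trianglerighteq$-upper bound if $P\trianglerighteq P'$ for every profile $P'$. Here $P'$ ranges over all preference profiles on $X$.
   Formalization: Part (b) is stated only for at least two individuals or exactly one allocation: with one individual and at least two allocations it is false, since total indifference is minimal but not strict. N and X are taken nonempty. *)

(* Defs.v *)
From mathcomp Require Import all_boot.

Set Implicit Arguments.
Unset Strict Implicit.
Unset Printing Implicit Defensive.

(* [Pi x y] is the weak preference "x is at least as good as y". *)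
Record preference (X : finType) := Preference {
  wpref :> rel X;
  wpref_total : total wpref;
  wpref_trans : transitive wpref }.

Definition spref (X : finType) (Pi : preference X) : rel X :=
  fun x y => Pi x y && ~~ Pi y x.

Definition profile (I X : finType) := I -> preference X.

Section Profiles.

Variables I X : finType.
Implicit Types (P : profile I X) (x y z : X).

Definition strict_profile P : Prop :=
  forall (i : I) x x', x != x' -> spref (P i) x x' \/ spref (P i) x' x.

Definition rank (Pi : preference X) x : nat := 1 + #|[set z | spref Pi z x]|.

Definition rankv P x : {ffun I -> nat} := [ffun i => rank (P i) x].

Definition rankv_le (r s : {ffun I -> nat}) : Prop := forall i, r i <= s i.

Definition pareto_dominates P z x : bool :=
  [forall i, P i z x] && [exists i, spref (P i) z x].

Definition PE P : {set X} := [set x | ~~ [exists z, pareto_dominates P z x]].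

Definition tge P P' : Prop :=
  exists psi : {x : X | x \in PE P'} -> {y : X | y \in PE P},
    (forall v, exists u, psi u = v) /\
    (forall u, rankv_le (rankv P (val (psi u))) (rankv P' (val u))).

Definition teq P P' : Prop := tge P P' /\ tge P' P.

Definition tge_maximal P : Prop := forall P', tge P' P -> teq P' P.

Definition tge_minimal P : Prop := forall P', tge P P' -> teq P P'.

Definition tge_upper_bound P : Prop := forall P', tge P P'.

End Profiles.

(* Main.v *)
Require Import Defs.
From mathcomp Require Import all_boot.
From mathcomp Require Import all_fingroup.

Set Implicit Arguments.
Unset Strict Implicit.
Unset Printing Implicit Defensive.

(** Part (a): an element ranked first by everybody weakly dominates everything,
    so when it is unique it is the only efficient one; and a profile in which
    all individuals share one linear order forces this shape on an upper bound.

    Part (b): for a fixed individual, the sum of the ranks over all allocations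
    is largest exactly for strict preferences. Comparing the sums makes a strict
    profile with [PE = X] minimal. Conversely, below any profile there is a
    strict one with [PE = X]: break ties (one individual in the opposite
    direction to the others), and then, as long as some allocation is
    inefficient, exchange it with a suitable dominating one in the preference
    of a single individual [a]. Efficient allocations remain efficient and the
    sum of the [a]-ranks of the inefficient ones decreases. *)

(** * Ranks in a single preference *)

Section Preferences.
Context {X : finType}.
Implicit Types (Pi Qi : preference X) (x y z : X).

Lemma wpref_refl Pi x : Pi x x.
Proof. by have := wpref_total Pi x x; rewrite orbb. Qed.

Lemma sprefE Pi x y : spref Pi x y = ~~ Pi y x.
Proof.
rewrite /spref; case: (boolP (Pi y x)) => [|nyx]; first by rewrite andbF.
by have := wpref_total Pi x y; rewrite (negbTE nyx) orbF => ->.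
Qed.

Lemma leq_rank Pi x y : (rank Pi x <= rank Pi y) = Pi x y.
Proof.
have mono u v : Pi u v -> rank Pi u <= rank Pi v.
  move=> uv; rewrite leq_add2l; apply/subset_leq_card/subsetP => z.
  by rewrite !inE !sprefE; apply: contra; apply: wpref_trans.
case: (boolP (Pi x y)) => [/mono //|nxy]; apply/negbTE; rewrite -ltnNge.
rewrite /rank ltn_add2l; apply/proper_card/properP; split.
  apply/subsetP => z; rewrite !inE !sprefE; apply: contra => xz.
  apply: wpref_trans xz.
  by have := wpref_total Pi x y; rewrite (negbTE nxy).
by exists y; rewrite !inE sprefE // wpref_refl.
Qed.

Lemma ltn_rank Pi x y : (rank Pi x < rank Pi y) = spref Pi x y.
Proof. by rewrite ltnNge leq_rank sprefE. Qed.

Lemma rank_eq1P Pi x : reflect (forall y, Pi x y) (rank Pi x == 1).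
Proof.
rewrite /rank -[1]addn0 eqn_add2l cards_eq0.
apply: (iffP eqP) => [e y|best].
  by have /setP/(_ y) := e; rewrite !inE sprefE => /negbFE.
by apply/setP => z; rewrite !inE sprefE best.
Qed.

(** In twice the sum, each ordered pair of distinct allocations counts once if strictly ranked and
    not at all if tied, while each diagonal pair counts the leading [1] of [rank] twice. *)
Lemma rank_sum_leqif Pi :
  (\sum_x rank Pi x).*2 <= #|X| * #|X|.+1
    ?= iff [forall x, forall y, (x != y) ==> spref Pi x y || spref Pi y x].
Proof.
have sum_eq x : \sum_(y : X) (x == y) = 1.
  by rewrite -(big_mkcond (fun y => x == y) (fun=> 1)) (big_pred1 x).
have rankE x : rank Pi x = \sum_y ((x == y) + spref Pi y x).
  by rewrite big_split /= sum_eq /rank -sum1dep_card big_mkcond.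
have -> : (\sum_x rank Pi x).*2 =
    \sum_x \sum_y (((x == y) + spref Pi y x) + ((x == y) + spref Pi x y)).
  rewrite -addnn {2}(eq_bigr _ (fun x _ => rankE x)) exchange_big /=.
  rewrite (eq_bigr _ (fun x _ => rankE x)) -big_split /=.
  apply: eq_bigr => x _; rewrite -big_split /=; apply: eq_bigr => y _.
  by rewrite [y == x]eq_sym.
have -> : #|X| * #|X|.+1 = \sum_(x : X) \sum_(y : X) (1 + (x == y)).
  rewrite -sum_nat_const; apply: eq_bigr => x _; rewrite big_split /=.
  by rewrite sum1_card sum_eq addn1.
apply: leqif_sum => x _; apply: leqif_sum => y _.
rewrite !sprefE; have [<-|_] := eqVneq x y; first by rewrite wpref_refl.
by have := wpref_total Pi x y; case: (Pi x y); case: (Pi y x).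
Qed.

Lemma rank_sum_max Pi Qi :
  (forall x y, x != y -> spref Qi x y \/ spref Qi y x) ->
  \sum_x rank Pi x <= \sum_x rank Qi x.
Proof.
move=> strQ; rewrite -leq_double (leq_trans (rank_sum_leqif Pi)) //.
rewrite eq_leq //; apply/esym/eqP; rewrite (rank_sum_leqif Qi).
apply/forallP => x; apply/forallP => y; apply/implyP => /strQ.
by move/orP.
Qed.

End Preferences.

(** * Pareto efficiency and the order [tge] *)

Section Dominance.
Context {I X : finType}.
Implicit Types (P : profile I X) (x y z : X).

(** A weak dominator of [x] with least rank sum is efficient, since whatever dominates it weakly
    dominates [x] with a smaller sum. *)
Lemma exists_PE P x : exists2 y, y \in PE P & forall i, P i y x.
Proof.
have Rx : [forall i, P i x x] by apply/forallP => i; apply: wpref_refl.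
case: (arg_minnP (P := fun y => [forall i, P i y x])
                 (fun y => \sum_i rank (P i) y) Rx) => y /forallP yx ymin.
exists y => //; rewrite inE; apply/existsP => -[z /andP[/forallP zy /existsP[j zyj]]].
have /ymin : [forall i, P i z x].
  by apply/forallP => i; apply: wpref_trans (yx i); apply: zy.
apply/negP; rewrite -ltnNge (bigD1 j) // [X in _ < X](bigD1 j) //=.
rewrite -addSn leq_add ?ltn_rank //.
by apply: leq_sum => i _; rewrite leq_rank.
Qed.

Lemma rankv_eq1P P x :
  rankv P x = [ffun _ => 1] <-> forall i y, P i x y.
Proof.
split=> [/ffunP e i|best].
  by apply/rank_eq1P; have := e i; rewrite !ffunE => ->.
by apply/ffunP => i; rewrite !ffunE; apply/eqP/rank_eq1P/best.
Qed.

Lemma best_PE P x : (forall i y, P i x y) -> x \in PE P.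
Proof.
move=> best; rewrite inE; apply/existsP => -[z /andP[_ /existsP[i]]].
by rewrite sprefE best.
Qed.

(** The map is the identity on [PE P], which makes it onto. *)
Lemma tge_intro P P' :
  PE P \subset PE P' ->
  (forall x, x \in PE P -> forall i, rank (P i) x <= rank (P' i) x) ->
  (forall x, exists2 y, y \in PE P &
     forall i, rank (P i) y <= rank (P' i) x) ->
  tge P P'.
Proof.
move=> sPP' leP exP.
have ex x : exists y, [&& y \in PE P, (x \in PE P) ==> (y == x) &
    [forall i, rank (P i) y <= rank (P' i) x]].
  case: (boolP (x \in PE P)) => [xP|_].
    by exists x; rewrite xP eqxx; apply/forallP; apply: leP.
  by have [y yP yx] := exP x; exists y; rewrite yP; apply/forallP.
pose g x := xchoose (ex x).
have gP x : g x \in PE P by have /and3P[] := xchooseP (ex x).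
exists (fun u => exist _ (g (val u)) (gP (val u))); split=> [[y yP]|u i].
  exists (exist _ y (subsetP sPP' y yP)); apply: val_inj => /=.
  by have /and3P[_ /implyP/(_ yP)/eqP] := xchooseP (ex y).
by rewrite !ffunE; have /and3P[_ _ /forallP] := xchooseP (ex (val u)).
Qed.

Lemma tge_intro_perm P P' (s : {perm X}) :
  PE P = [set: X] -> PE P' = [set: X] ->
  (forall i x, rank (P i) (s x) <= rank (P' i) x) -> tge P P'.
Proof.
move=> PT P'T les.
have inP x : x \in PE P by rewrite PT inE.
have inP' x : x \in PE P' by rewrite P'T inE.
exists (fun u => exist _ (s (val u)) (inP _)); split=> [[y yP]|u i].
  by exists (exist _ (s^-1%g y) (inP' _)); apply: val_inj; rewrite /= permKV.
by rewrite !ffunE les.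
Qed.

(** Choosing preimages under the surjection gives an injection of a finite type into itself, hence a
    permutation; its values are efficient under [P'], and its inverse is [s]. *)
Lemma tge_perm P P' :
  PE P = [set: X] -> tge P P' ->
  PE P' = [set: X] /\
  exists s : {perm X}, forall i x, rank (P i) (s x) <= rank (P' i) x.
Proof.
move=> PT [psi [onto le]].
have inP x : x \in PE P by rewrite PT inE.
have ex y : exists u, psi u == exist _ y (inP y).
  by have [u <-] := onto (exist _ y (inP y)); exists u.
pose h y := val (xchoose (ex y)).
have psih y : val (psi (xchoose (ex y))) = y by rewrite (eqP (xchooseP (ex y))).
have h_inj : injective h.
  by move=> y z /val_inj e; rewrite -[y]psih -[z]psih e.
have hP' y : h y \in PE P' by apply: valP (xchoose (ex y)).
split.
  apply/setP => x; rewrite in_setT -(permKV (perm h_inj) x) permE.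
  exact: hP'.
exists (perm h_inj)^-1%g => i x.
set y := _ x; rewrite -(permKV (perm h_inj) x) -/y permE.
by have := le (xchoose (ex y)) i; rewrite !ffunE psih.
Qed.

(** The termwise inequalities [les] add up to an inequality that strictness of [P] reverses, so each
    of them is an equality. *)
Lemma strict_efficient_minimal P :
  PE P = [set: X] -> strict_profile P -> tge_minimal P.
Proof.
move=> PT strP P' PP'; split=> //.
have [P'T [s les]] := tge_perm PT PP'.
apply: (tge_intro_perm (s := s^-1%g)) => // i x.
have: \sum_x rank (P i) (s x) == \sum_x rank (P' i) x.
  rewrite eqn_leq leq_sum //=.
  have <- : \sum_x rank (P i) x = \sum_x rank (P i) (s x).
    exact: reindex_inj perm_inj.
  exact: rank_sum_max (strP i).
have le_sum := leqif_sum (fun x _ => leqif_eq (les i x)).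
rewrite le_sum => /forall_inP/(_ (s^-1%g x) isT)/eqP <-.
by rewrite permKV.
Qed.

End Dominance.

(** * Strict preferences as permutations *)

Section Positions.
Context {m : nat}.
Implicit Types (p : {perm 'I_m}) (x y z : 'I_m).

Fact position_total p : total (fun x y => p x <= p y).
Proof. by move=> x y; apply: leq_total. Qed.

Fact position_trans p : transitive (fun x y => p x <= p y).
Proof. by move=> y x z; apply: leq_trans. Qed.

(** [p x] is the position of [x], with the best at [0], so exchanging two allocations is composing
    with a transposition. *)
Definition position_pref p : preference 'I_m :=
  Preference (@position_total p) (@position_trans p).

Lemma spref_position p x y : spref (position_pref p) x y = (p x < p y).
Proof. by rewrite sprefE -ltnNge. Qed.

Lemma card_before p x : #|[set z | p z < p x]| = p x.
Proof.
rewrite -sum1dep_card.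
have <- : \sum_(z < m | z < p x) 1 = \sum_(z | p z < p x) 1.
  exact: reindex_inj perm_inj.
rewrite -(big_ord_widen m (fun=> 1)) ?sum1_card ?card_ord //.
exact: ltnW.
Qed.

Lemma rank_position p x : rank (position_pref p) x = (p x).+1.
Proof.
rewrite /rank add1n -[in RHS](card_before p x); congr _.+1.
by apply: eq_card => z; rewrite !inE spref_position.
Qed.

Lemma strict_position (I : finType) (s : I -> {perm 'I_m}) :
  strict_profile (fun i => position_pref (s i)).
Proof.
move=> i x y; rewrite !spref_position => nxy; apply/orP.
by rewrite -neq_ltn (inj_eq val_inj) (inj_eq perm_inj).
Qed.

(** The number of predecessors serves as the position. *)
Lemma linear_extension (lt : rel 'I_m) :
  irreflexive lt -> transitive lt ->
  (forall x y, x != y -> lt x y || lt y x) ->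
  exists p, forall x y, lt x y -> p x < p y.
Proof.
move=> irr tr tot.
have fP x : #|[set z | lt z x]| < m.
  rewrite -[X in _ < X](card_ord m) -cardsT; apply/proper_card/properP.
  by split; [apply: subsetT | exists x; rewrite !inE ?irr].
pose f x := Ordinal (fP x).
have mono x y : lt x y -> f x < f y.
  move=> xy; apply/proper_card/properP; split.
    by apply/subsetP => z; rewrite !inE => /tr; apply.
  by exists x; rewrite !inE ?irr.
have f_inj : injective f.
  move=> x y e; apply/eqP/negPn/negP => /tot /orP[] /mono; by rewrite e ltnn.
by exists (perm f_inj) => x y; rewrite !permE; apply: mono.
Qed.

(** The order is lexicographic: first the preference, then [t]. *)
Lemma tie_breaking (Pi : preference 'I_m) (t : 'I_m -> nat) :
  injective t ->
  exists p, (forall x y, spref Pi x y -> p x < p y) /\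
            (forall x y, Pi x y -> t x < t y -> p x < p y).
Proof.
move=> t_inj.
have [|||p pP] := @linear_extension
  (fun x y => Pi x y && (spref Pi x y || (t x < t y))).
- by move=> x; rewrite ltnn orbF sprefE wpref_refl.
- move=> y x z /andP[xy txy] /andP[yz tyz].
  rewrite (wpref_trans xy yz) sprefE /=.
  case: (boolP (Pi z x)) => //= zx.
  move: txy tyz; rewrite !sprefE (wpref_trans yz zx) (wpref_trans zx xy) /=.
  exact: ltn_trans.
- move=> x y nxy; rewrite !sprefE.
  have := wpref_total Pi x y; case: (Pi x y); case: (Pi y x) => //= _.
  by rewrite -neq_ltn (inj_eq t_inj).
exists p; split=> x y.
  by move=> sxy; apply: pP; rewrite sxy andbT; case/andP: sxy.
by move=> xy txy; apply: pP; rewrite xy txy orbT.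
Qed.

(** * A strict efficient profile below a given one *)

Context {I : finType}.
Implicit Types (s : I -> {perm 'I_m}) (P : profile I 'I_m).

Definition positions s : profile I 'I_m := fun i => position_pref (s i).

(** Distinct allocations are never tied here, so dominance is strict for everyone; [a] witnesses
    that there is an individual. *)
Lemma dominates_positions (a : I) s x y :
  pareto_dominates (positions s) x y = [forall i, s i x < s i y].
Proof.
apply/andP/forallP => [[/forallP le /existsP[j]]|lt].
  rewrite spref_position => ltj i; rewrite ltn_neqAle (le i : s i x <= s i y) andbT.
  rewrite (inj_eq val_inj) (inj_eq perm_inj).
  by apply: contraTneq ltj => ->; rewrite ltnn.
split; first by apply/forallP => i; apply: ltnW.
by apply/existsP; exists a; rewrite spref_position.
Qed.

Lemma PE_positionsPn (a : I) s x :
  reflect (exists y, forall i, s i y < s i x) (x \notin PE (positions s)).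
Proof.
rewrite inE negbK; apply: (iffP existsP) => -[y].
  by rewrite (dominates_positions a) => /forallP; exists y.
by move=> lt; exists y; rewrite (dominates_positions a); apply/forallP.
Qed.

(* Stronger than [tge]: the last clause is asked of all [x], not only of the
   efficient ones, so that it survives exchanges that make more [x] efficient. *)
Definition below P s :=
  [/\ PE P \subset PE (positions s),
      forall x, x \in PE P -> forall i, rank (P i) x <= (s i x).+1 &
      forall x, exists2 y, y \in PE P & forall i, rank (P i) y <= (s i x).+1].

Lemma below_tge P s : below P s -> tge P (positions s).
Proof.
case=> sub le ex; apply: tge_intro => // x.
  by move=> xP i; rewrite rank_position le.
by have [y yP yx] := ex x; exists y => // i; rewrite rank_position.
Qed.

Variables (a b : I) (nab : a != b).

(** Individual [a] breaks ties by index and all others, among them [b], by reversed index. An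
    efficient [x] dominated afterwards by some [y] would be tied with [y] for everybody, and [a] and
    [b] cannot both resolve this tie in favour of [y]. *)
Lemma exists_below P : exists s, below P s.
Proof.
pose t i (x : 'I_m) := if i == a then x : nat else m - x.
have t_inj i : injective (t i).
  move=> x y; rewrite /t; case: eqP => _; first exact: val_inj.
  by move/eqP; rewrite eqn_sub2lE ?(ltnW (ltn_ord _)) // => /eqP/val_inj.
(* A boolean property, so that [xchoose] can pick one permutation per individual. *)
have ex i : exists p : {perm 'I_m},
    [forall x, forall y, (spref (P i) x y ==> (p x < p y)) &&
                         (P i x y && (t i x < t i y) ==> (p x < p y))].
  have [p [sp tp]] := tie_breaking (P i) (t_inj i); exists p.
  apply/forallP => x; apply/forallP => y; apply/andP; split; apply/implyP.
    exact: sp.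
  by case/andP; apply: tp.
pose s i := xchoose (ex i).
have sP i x y : spref (P i) x y -> s i x < s i y.
  by have /forallP/(_ x)/forallP/(_ y)/andP[/implyP] := xchooseP (ex i).
have tP i x y : P i x y -> t i x < t i y -> s i x < s i y.
  move=> xy txy.
  have /forallP/(_ x)/forallP/(_ y)/andP[_ /implyP] := xchooseP (ex i).
  by rewrite xy txy; apply.
have le_s i x : rank (P i) x <= (s i x).+1.
  rewrite /rank add1n ltnS -(card_before (s i) x).
  by apply/subset_leq_card/subsetP => z; rewrite !inE; apply: sP.
exists s; split=> [|x _ i //|x]; last first.
  have [y yP yx] := exists_PE P x; exists y => // i.
  by apply: leq_trans (le_s i x); rewrite leq_rank.
apply/subsetP => x xP; apply/negPn/negP => /(PE_positionsPn a)[y lt].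
have yx i : P i y x.
  by apply/negPn; rewrite -sprefE; apply/negP => /sP; rewrite ltnNge ltnW.
have xy i : P i x y.
  apply/negPn; rewrite -sprefE; apply/negP => syx.
  move: xP; rewrite inE => /existsP[]; exists y; apply/andP; split.
    exact/forallP.
  by apply/existsP; exists i.
have le_t i : t i y <= t i x.
  by rewrite leqNgt; apply/negP => /(tP _ _ _ (xy i)); rewrite ltnNge ltnW.
have := le_t a; have := le_t b.
rewrite /t eqxx eq_sym (negbTE nab) leq_sub2lE ?(ltnW (ltn_ord _)) // => le1 le2.
have e : x = y by apply/val_inj/eqP; rewrite eqn_leq le1 le2.
by have := lt a; rewrite e ltnn.
Qed.

(** Among the inefficient allocations [z] is the best one for [a], and [y] is the dominator of [z]
    that [a] likes least; these two are exchanged for [a]. *)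
Lemma below_improve P s :
  below P s -> PE (positions s) != [set: 'I_m] ->
  exists s', below P s' /\
    \sum_(x | x \notin PE (positions s')) s' a x
      < \sum_(x | x \notin PE (positions s)) s a x.
Proof.
move=> [sub le ex] neT.
have [z0 nz0] : exists z, z \notin PE (positions s).
  apply/existsP; apply: contraNT neT => /existsPn all.
  by apply/eqP/setP => x; rewrite in_setT; apply/negPn/all.
(* Minimality of [z] makes all its dominators efficient. *)
case: (arg_minnP (P := fun x => x \notin PE (positions s))
  (fun x => s a x : nat) nz0) => z nz zmin.
have domPE w : (forall i, s i w < s i z) -> w \in PE (positions s).
  by move=> wz; apply: contraTT (wz a) => /zmin; rewrite -leqNgt.
have [y0 dy0] := PE_positionsPn a s z nz.
case: (arg_maxnP (P := fun y => [forall i, s i y < s i z])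
  (fun x => s a x : nat) (introT forallP dy0)) => y /forallP yz ymax.
have yP := domPE _ yz.
have nyz : y != z by apply: contraTneq (yz a) => ->; rewrite ltnn.
pose s' i := if i == a then (tperm y z * s a)%g else s i.
have s'a x : s' a x = s a (tperm y z x) by rewrite /s' eqxx permM.
have s'n i x : i != a -> s' i x = s i x by rewrite /s' => /negbTE ->.
have s'D i x : x != y -> x != z -> s' i x = s i x.
  move=> xy xz; have [->|/s'n //] := eqVneq i a.
  by rewrite s'a tpermD // eq_sym.
have le_y i : s i y <= s' i y.
  by have [->|/s'n -> //] := eqVneq i a; rewrite s'a tpermL ltnW.
have le_z i : s i y <= s' i z.
  have [->|/s'n ->] := eqVneq i a; first by rewrite s'a tpermR.
  exact: ltnW.
(* The new position of [z] is never better than the old one of [y], so [y] can stand in for [z] when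
   a dominator under [s'] is pulled back to [s]. *)
have le_s' x : exists2 w, (x != z -> w = x) & forall i, s i w <= s' i x.
  have [->|xz] := eqVneq x z; first by exists y.
  exists x => // i; have [->//|xy] := eqVneq x y.
  by rewrite s'D.
have effPE x : x \in PE (positions s) -> x \in PE (positions s').
  move=> xP; apply/negPn/negP => /(PE_positionsPn a)[w wx].
  have xz : x != z by apply: contraNneq nz => <-.
  have [exy|xy] := eqVneq x y; last first.
    have [w0 _ w0w] := le_s' w.
    case/PE_positionsPn: xP; first exact: a.
    exists w0 => i; rewrite -(s'D i x) //; exact: leq_ltn_trans (w0w i) (wx i).
  (* A dominator [w] of [y] under [s'] dominates [z] under [s]; the choice of [y] then puts [w]
     before [y] for [a], so [w] dominates [y] already under [s]. *)
  subst x; have wz : w != z.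
    apply: contraTneq (wx b) => ->; have ba : b != a by rewrite eq_sym.
    by rewrite !s'n // -leqNgt ltnW.
  have wy : w != y by apply: contraTneq (wx a) => ->; rewrite ltnn.
  have dwz : [forall i, s i w < s i z].
    apply/forallP => i; have := wx i; rewrite s'D //.
    have [->|ia] := eqVneq i a; first by rewrite s'a tpermL.
    by rewrite s'n // => /ltn_trans; apply.
  have wya : s a w < s a y.
    rewrite ltn_neqAle (ymax w dwz : s a w <= s a y) andbT.
    by rewrite (inj_eq val_inj) (inj_eq perm_inj).
  case/PE_positionsPn: yP; first exact: a.
  exists w => i; have [->//|ia] := eqVneq i a.
  by have := wx i; rewrite !s'n.
exists s'; split.
  split.
  - by apply/subsetP => x /(subsetP sub)/effPE.
  - move=> x xP i; have xz : x != z.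
      by apply: contraNneq nz => <-; apply: (subsetP sub).
    have [w /(_ xz) -> wx] := le_s' x.
    by apply: leq_trans (le x xP i) _; rewrite ltnS.
  - move=> x; have [w _ wx] := le_s' x; have [v vP vw] := ex w.
    by exists v => // i; apply: leq_trans (vw i) _; rewrite ltnS.
(* No allocation becomes inefficient, and among those inefficient under [s] only [z] moves, to the
   former place of [y]. *)
apply: (@leq_ltn_trans (\sum_(x | x \notin PE (positions s)) s' a x)).
  rewrite big_mkcond [X in _ <= X]big_mkcond /=; apply: leq_sum => x _.
  have := effPE x; case: (x \in PE (positions s)) => /= [-> //|_].
  by case: ifP.
rewrite (bigD1 z) // [X in _ < X](bigD1 z) //= s'a tpermR -addSn leq_add //.
apply: leq_sum => x /andP[nx xz]; rewrite s'D //.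
by apply: contraNneq nx => ->.
Qed.

Lemma exists_strict_efficient_below P :
  exists s, tge P (positions s) /\ PE (positions s) = [set: 'I_m].
Proof.
have [s0 Ps0] := exists_below P.
have [k] := ubnP (\sum_(x | x \notin PE (positions s0)) s0 a x).
elim: k s0 Ps0 => // k IHk s Ps; rewrite ltnS => le_k.
have [e|ne] := eqVneq (PE (positions s)) [set: 'I_m].
  by exists s; split=> //; apply: below_tge.
have [s' [Ps' lt]] := below_improve Ps ne.
exact: IHk Ps' (leq_trans lt le_k).
Qed.

(** Minimality returns a comparison with a strict profile, whose rank sums are maximal; hence so are
    those of [P], and the equality case of [rank_sum_leqif] is strictness. *)
Lemma minimal_strict_efficient P :
  tge_minimal P -> PE P = [set: 'I_m] /\ strict_profile P.
Proof.
move=> minP; have [s [Ps sT]] := exists_strict_efficient_below P.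
have [_ /(tge_perm sT)[PT [q leq_q]]] := minP _ Ps.
split=> // i x y nxy; apply/orP; move: nxy; apply/implyP.
move: y; apply/forallP; move: x; apply/forallP.
rewrite -(rank_sum_leqif (P i)) eqn_leq (rank_sum_leqif (P i)) /=.
have <- : (\sum_x rank (positions s i) x).*2 = #|'I_m| * #|'I_m|.+1.
  apply/eqP; rewrite rank_sum_leqif.
  apply/forallP => x; apply/forallP => y; apply/implyP => nxy; apply/orP.
  exact: strict_position.
rewrite leq_double (reindex_inj (h := q) perm_inj) /=.
exact: leq_sum.
Qed.

End Positions.

(** * Upper bounds and the two characterizations *)

Lemma upper_bound_iff (I : finType) (m : nat) (P : profile I 'I_m) :
  0 < #|I| -> 0 < m ->
  (tge_maximal P /\ tge_upper_bound P) <->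
  (exists! xs : 'I_m, rankv P xs = [ffun _ => 1]).
Proof.
move=> /card_gt0P[a _] m_gt0; split.
  (* In the test profile everybody ranks by index, so only [o] is efficient, with rank 1 for all;
     its image must exhaust [PE P] and be first for everybody. *)
  case=> _ /(_ (positions (fun=> 1%g))) [psi [onto le]].
  pose o := Ordinal m_gt0.
  have PE_o x : x \in PE (@positions m I (fun=> 1%g)) -> x = o.
    move=> xP; apply/val_inj/eqP; rewrite -leqn0 leqNgt; apply/negP => x_gt0.
    by case/(PE_positionsPn a): xP; exists o => i; rewrite !perm1.
  have uniq_PE x y : x \in PE P -> y \in PE P -> x = y.
    move=> xP yP.
    have [[u uP] eu] := onto (exist _ x xP).
    have [[v vP] ev] := onto (exist _ y yP).
    have e : exist (fun x => x \in _) u uP = exist (fun x => x \in _) v vP.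
      by apply: val_inj; rewrite /= (PE_o u uP) (PE_o v vP).
    by move: (congr1 val eu); rewrite e ev /= => ->.
  have [x xP _] := exists_PE P o.
  have best : rankv P x = [ffun _ => 1].
    have [[u uP] eu] := onto (exist _ x xP).
    apply/ffunP => i; have := le (exist _ u uP) i.
    rewrite eu !ffunE rank_position /= (PE_o u uP) perm1 => le1.
    by apply/eqP; rewrite eqn_leq le1.
  by exists x; split=> // y /rankv_eq1P/best_PE; apply: uniq_PE.
case=> x [/rankv_eq1P best uniq_x].
have xP := best_PE best.
(* An efficient [y] ties with [x] for everybody, so it is also best, and uniqueness applies. *)
have PEx y : y \in PE P -> y = x.
  move=> yP; apply/esym/uniq_x/rankv_eq1P => i z.
  apply: wpref_trans (best i z); apply/negPn; rewrite -sprefE; apply/negP => sxy.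
  move: yP; rewrite inE => /existsP[]; exists x; apply/andP; split.
    by apply/forallP.
  by apply/existsP; exists i.
have upP : tge_upper_bound P.
  (* A constant map is onto the singleton [PE P] because [PE P'] is nonempty. *)
  move=> P'; exists (fun=> exist _ x xP); split=> [[y yP]|u i].
    have [z zP _] := exists_PE P' x.
    by exists (exist _ z zP); apply: val_inj; rewrite /= (PEx y yP).
  by rewrite !ffunE; have /rank_eq1P/eqP -> := best i.
by split=> // P' P'P; split.
Qed.

(** With one individual and several allocations, total indifference is minimal without being strict,
    which is why the second half leaves that case out. *)
Theorem theorem1 (n m : nat) (n_gt0 : 0 < n) (m_gt0 : 0 < m) :
  (forall P : profile 'I_n 'I_m,
     (tge_maximal P /\ tge_upper_bound P) <->
     (exists! xs : 'I_m, rankv P xs = [ffun _ : 'I_n => 1]))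
  /\
  ((1 < n \/ m = 1) ->
   forall P : profile 'I_n 'I_m,
     tge_minimal P <-> (PE P = [set: 'I_m] /\ strict_profile P)).
Proof.
split=> [P|n_m P]; first by apply: upper_bound_iff; rewrite ?card_ord.
split=> [minP|[]]; last exact: strict_efficient_minimal.
case: n_m => [n_gt1|m1].
  exact: (minimal_strict_efficient (a := Ordinal n_gt0) (b := Ordinal n_gt1)).
have eqX (x y : 'I_m) : x = y.
  by apply: val_inj; case: x y => x + [y +] /=; rewrite m1; case: x; case: y.
split=> [|i x y]; last by rewrite (eqX x y) eqxx.
apply/setP => x; rewrite in_setT; have [y yP _] := exists_PE P x.
by rewrite (eqX x y).
Qed.
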